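(* Let $m\ge1$ be an integer, let $D\subset\mathbb{R}^2$ be a compact convex domain, let $V_1,V_2,V_3\in D$ be the vertices of a non-degenerate triangle, and let $f\in C^{m,1}(D)$. Then for each $\boldsymbol{x}\in D$, $$\lim_{h\to0^+}P_{m}^{[\Delta_2(V_1,\,V_1+h(V_2-V_1),\,V_1+h(V_3-V_1));V_1]}[f](\boldsymbol{x})=T_m[f,V_1](\boldsymbol{x}).$$
   Context: Function classes. $C^m(D)$ is the class of functions of class $C^m$ on $D$ in the sense of Whitney (restrictions to $D$ of $C^m$ functions on $\mathbb{R}^2$). $C^{m,1}(D)$ is the class of $f\in C^m(D)$ whose partial derivatives $\frac{\partial^m f}{\partial x^{m-j}\partial y^j}$, $j=0,\dots,m$, are Lipschitz continuous on $D$. Generalized Taylor polynomial. Let $U_1,U_2,U_3$ be the vertices of a non-degenerate triangle in $D$. $A(P,Q,R)$ is the determinant of the $3\times3$ matrix whose columns are $(1,P)^T,(1,Q)^T,(1,R)^T$; $\lambda_2=\frac{A(U_1,\boldsymbol{x},U_3)}{A(U_1,U_2,U_3)}$ and $\lambda_3=\frac{A(U_1,U_2,\boldsymbol{x})}{A(U_1,U_2,U_3)}$ are barycentric coordinates of $\boldsymbol{x}\in\mathbb{R}^2$. $\Delta_2(U_1,U_2,U_3)$ is the convex hull of $U_1,U_2,U_3$. For $i\ne j$, $D_{ij}f=(U_i-U_j)\cdot\nabla f$, and for $\beta=(\beta_1,\beta_2)$ with non-negative integer components, $D_1^\beta=D_{21}^{\beta_1}D_{31}^{\beta_2}$, $D_2^\beta=D_{12}^{\beta_1}D_{32}^{\beta_2}$,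 $D_3^\beta=D_{13}^{\beta_1}D_{23}^{\beta_2}$. Bernoulli polynomials: $B_0(x)=1$, $B_n'(x)=nB_{n-1}(x)$ and $\int_0^1B_n(x)\,dx=0$ for $n\ge1$; $S_k(x)=B_k(x)-B_k(0)$. Then $$\begin{aligned}P_{m}^{[\Delta_2(U_1,U_2,U_3);U_1]}[f](\boldsymbol{x})=&f(U_1)+\sum_{j=1}^{m}\left(D_1^{(0,j-1)}f(U_3)-D_1^{(0,j-1)}f(U_1)\right)\frac{S_j(\lambda_2+\lambda_3)}{j!}\\&+\sum_{i=1}^{m}\sum_{j=1}^{m-i+1}\Big((-1)^{i+j}\big(D_2^{(j-1,i-1)}f(U_2)-D_2^{(j-1,i-1)}f(U_1)\big)\\&\quad+(-1)^j\big(D_3^{(j-1,i-1)}f(U_3)-D_3^{(j-1,i-1)}f(U_1)\big)\Big)\frac{(\lambda_2+\lambda_3)^{i-1}S_i\left(\frac{\lambda_2}{\lambda_2+\lambda_3}\right)}{i!}\frac{S_j(\lambda_2+\lambda_3)}{j!},\end{aligned}$$ where the products $(\lambda_2+\lambda_3)^{i-1}S_i\left(\frac{\lambda_2}{\lambda_2+\lambda_3}\right)S_j(\lambda_2+\lambda_3)$ are understood as polynomials in $\lambda_2,\lambda_3$ also where $\lambda_2+\lambda_3=0$. $T_m[f,V_1]$ is the Taylor polynomial of order $m$ of $f$ at $V_1=(x_1,y_1)$: $T_m[f,V_1](\boldsymbol{x})=\sum_{|\alpha|\le m}\frac{1}{\alpha!}\frac{\partial^{|\alpha|}f}{\partial x^{\alpha_1}\partial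 y^{\alpha_2}}(V_1)(x-x_1)^{\alpha_1}(y-y_1)^{\alpha_2}$. *)

(* Defs.v *)
From HB Require Import structures.
From mathcomp Require Import all_boot all_order all_algebra.
From mathcomp Require Import all_classical all_reals all_analysis.

Set Implicit Arguments.
Unset Strict Implicit.
Unset Printing Implicit Defensive.

Import Order.TTheory GRing.Theory Num.Theory.
Import numFieldNormedType.Exports.

Local Open Scope classical_set_scope.
Local Open Scope ring_scope.

Notation plane R := 'rV[R]_2.

(** The coordinates x and y of the plane have index 0 and 1. *)

Definition partial (R : realType) (i : 'I_2) (f : plane R -> R) : plane R -> R :=
  fun x => 'D_(delta_mx 0 i) f x.

Definition mpartial (R : realType) (a b : nat) (f : plane R -> R) : plane R -> R :=
  iter a (partial 0) (iter b (partial 1) f).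

Definition grad (R : realType) (f : plane R -> R) (x : plane R) : plane R :=
  \row_(i < 2) partial i f x.

Definition dotp (R : realType) (u v : plane R) : R :=
  \sum_(i < 2) u 0 i * v 0 i.

Definition ddir (R : realType) (v : plane R) (f : plane R -> R) : plane R -> R :=
  fun x => dotp v (grad f x).

Fixpoint Cm (R : realType) (m : nat) (f : plane R -> R) : Prop :=
  continuous f /\
  if m is m'.+1 then
    forall i : 'I_2,
      (forall x, derivable f x (delta_mx 0 i)) /\ Cm m' (partial i f)
  else True.

(** [Cm_ext m D f F] : F witnesses that f is of class C^m on D in the sense of
    Whitney.  The partial derivatives of order at most m of f at the points of
    D are by definition those of such an F; on a compact convex domain they
    do not depend on the choice of F, see [derivs_unique] below. *)

Definition Cm_ext (R : realType) (m : nat) (D : set (plane R))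
    (f F : plane R -> R) : Prop :=
  Cm m F /\ {in D, F =1 f}.

Definition Cm1_on (R : realType) (m : nat) (D : set (plane R))
    (f : plane R -> R) : Prop :=
  exists F, Cm_ext m D f F /\
    forall j, (j <= m)%N -> [lipschitz mpartial (m - j) j F x | x in D].

Definition compact_convex_domain (R : realType) (D : set (plane R)) : Prop :=
  [/\ compact D, convex_set (D : set (convex_lmodType (plane R))) & D° !=set0].

(** Barycentric coordinates: the j-th column of the matrix is (1, P_j)^T. *)

Definition area_det (R : realType) (P Q S : plane R) : R :=
  \det (\matrix_(i < 3, j < 3)
          (row_mx (1 : 'M[R]_1) (tnth [tuple P; Q; S] j) : 'rV[R]_3) 0 i).

Definition bary2 (R : realType) (U1 U2 U3 x : plane R) : R :=
  area_det U1 x U3 / area_det U1 U2 U3.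

Definition bary3 (R : realType) (U1 U2 U3 x : plane R) : R :=
  area_det U1 U2 x / area_det U1 U2 U3.

(** Bernoulli polynomials: B_{n+1} is the antiderivative of (n + 1) B_n with
    zero mean on [0, 1]. *)

Definition antideriv (R : realType) (p : {poly R}) : {poly R} :=
  'X * \poly_(i < size p) (p`_i / i.+1%:R).

Fixpoint bernoulli_poly (R : realType) (n : nat) : {poly R} :=
  if n is k.+1 then
    let q := antideriv (k.+1%:R *: bernoulli_poly R k) in
    q - (\int[lebesgue_measure]_(x in `[0%R, 1%R]) q.[x])%:P
  else 1.

Definition Spoly (R : realType) (k : nat) : {poly R} :=
  bernoulli_poly R k - (bernoulli_poly R k).[0]%:P.

(** [SS i j a s] is s^(i-1) S_i(a/s) S_j(s) as a polynomial in a and s: the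
    first factor is the homogenization s^i S_i(a/s), the second one is the
    polynomial S_j(s)/s, as S_j vanishes at 0. *)

Definition SS (R : realType) (i j : nat) (a s : R) : R :=
  (\sum_(k < i.+1) (Spoly R i)`_k * a ^+ k * s ^+ (i - k))
  * (drop_poly 1 (Spoly R j)).[s].

(** With D_ij f = (U_i - U_j) . grad f, the operators D_1^b = D_21^b1 D_31^b2,
    D_2^b = D_12^b1 D_32^b2 and D_3^b = D_13^b1 D_23^b2. *)

Definition Dop1 (R : realType) (U1 U2 U3 : plane R) (b1 b2 : nat)
    (f : plane R -> R) : plane R -> R :=
  iter b1 (ddir (U2 - U1)) (iter b2 (ddir (U3 - U1)) f).

Definition Dop2 (R : realType) (U1 U2 U3 : plane R) (b1 b2 : nat)
    (f : plane R -> R) : plane R -> R :=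
  iter b1 (ddir (U1 - U2)) (iter b2 (ddir (U3 - U2)) f).

Definition Dop3 (R : realType) (U1 U2 U3 : plane R) (b1 b2 : nat)
    (f : plane R -> R) : plane R -> R :=
  iter b1 (ddir (U1 - U3)) (iter b2 (ddir (U2 - U3)) f).

Definition gen_taylor (R : realType) (m : nat) (U1 U2 U3 : plane R)
    (f : plane R -> R) (x : plane R) : R :=
  let l2 := bary2 U1 U2 U3 x in
  let l3 := bary3 U1 U2 U3 x in
  let D1 := Dop1 U1 U2 U3 in
  let D2 := Dop2 U1 U2 U3 in
  let D3 := Dop3 U1 U2 U3 in
  f U1
  + \sum_(1 <= j < m.+1)
      (D1 0%N j.-1 f U3 - D1 0%N j.-1 f U1)
      * ((Spoly R j).[l2 + l3] / j`!%:R)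
  + \sum_(1 <= i < m.+1) \sum_(1 <= j < (m - i + 1).+1)
      ((-1) ^+ (i + j) * (D2 j.-1 i.-1 f U2 - D2 j.-1 i.-1 f U1)
       + (-1) ^+ j * (D3 j.-1 i.-1 f U3 - D3 j.-1 i.-1 f U1))
      * (SS i j l2 (l2 + l3) / (i`!%:R * j`!%:R)).

Definition taylor (R : realType) (m : nat) (f : plane R -> R)
    (V : plane R) (x : plane R) : R :=
  \sum_(a < m.+1) \sum_(b < m.+1 | (a + b <= m)%N)
    mpartial a b f V / (a`!%:R * b`!%:R)
    * (x 0 0 - V 0 0) ^+ a * (x 0 1 - V 0 1) ^+ b.

(** Checks that the explicit formulas above satisfy the properties that
    characterize them. *)

Lemma deriv_antideriv (R : realType) (p : {poly R}) : (antideriv p)^`() = p.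
Proof.
apply/polyP => i; rewrite coef_deriv coefXM /= coef_poly.
case: ltnP => hi; last by rewrite mul0rn nth_default.
by rewrite -[LHS]mulr_natr divfK // pnatr_eq0.
Qed.

Lemma int_horner (R : realType) (p : {poly R}) :
  \int[lebesgue_measure]_(x in `[0%R, 1%R]) p.[x]
  = (antideriv p).[1] - (antideriv p).[0].
Proof.
rewrite /Rintegral (@continuous_FTC2 _ _ (horner (antideriv p))) //=.
- exact/continuous_subspaceT/continuous_horner.
- split.
  + by move=> x _; exact: derivable_horner.
  + by apply: cvg_at_right_filter; exact: continuous_horner.
  + by apply: cvg_at_left_filter; exact: continuous_horner.
- by move=> x _; rewrite -derivE deriv_antideriv.
Qed.

Lemma bernoulli_poly0 (R : realType) : bernoulli_poly R 0 = 1.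
Proof. by []. Qed.

Lemma deriv_bernoulli_poly (R : realType) n :
  (bernoulli_poly R n.+1)^`() = n.+1%:R *: bernoulli_poly R n.
Proof. by rewrite /= derivB derivC subr0 deriv_antideriv. Qed.

Lemma int_bernoulli_poly (R : realType) n :
  \int[lebesgue_measure]_(x in `[0%R, 1%R]) (bernoulli_poly R n.+1).[x] = 0.
Proof.
pose q := antideriv (n.+1%:R *: bernoulli_poly R n).
pose c : R := \int[lebesgue_measure]_(x in `[0%R, 1%R]) q.[x].
have -> : bernoulli_poly R n.+1 = q - c%:P by [].
have aB (r s : {poly R}) : (antideriv (r - s)).[1] - (antideriv (r - s)).[0]
  = ((antideriv r).[1] - (antideriv r).[0])
    - ((antideriv s).[1] - (antideriv s).[0]).
  have -> : antideriv (r - s) = antideriv r - antideriv s.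
    apply/polyP => i; rewrite coefB !coefXM; case: i => [|i] /=.
      by rewrite subrr.
    rewrite !coef_poly coefB.
    have z (t : {poly R}) :
        (if (i < size t)%N then t`_i / i.+1%:R else 0) = t`_i / i.+1%:R.
      by case: ltnP => // h; rewrite nth_default // mul0r.
    rewrite !z -mulrBl -coefB; exact: z.
  by rewrite !hornerE !oppr0 !addr0.
rewrite int_horner aB -int_horner -/c.
have -> : antideriv c%:P = c *: 'X.
  apply/polyP => i; rewrite coefXM coefZ coefX coef_poly.
  case: i => [|i]; rewrite ?mulr0 //= coefC size_polyC.
  case: i => [|i] /=; last by rewrite mulr0; case: ltnP => //; rewrite mul0r.
  by case: eqP => [->|_]; rewrite ?divr1 ?mulr1 ?mul0r.
by rewrite !hornerE subr0 subrr.
Qed.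

Lemma size_bernoulli_poly (R : realType) n :
  (size (bernoulli_poly R n) <= n.+1)%N.
Proof.
elim: n => [|n IH]; first by rewrite size_poly1.
apply/leq_sizeP => -[//|j] hj; have := leq_sizeP _ _ IH j hj => h.
have := congr1 (fun p : {poly R} => p`_j) (deriv_bernoulli_poly R n).
rewrite coef_deriv coefZ h mulr0 => /eqP.
by rewrite mulrn_eq0 /= => /eqP.
Qed.

Lemma SSE (R : realType) i j (a s : R) : (0 < i)%N -> s != 0 ->
  SS i j a s = s ^+ i.-1 * (Spoly R i).[a / s] * (Spoly R j).[s].
Proof.
move=> i0 s0.
have sS : (size (Spoly R i) <= i.+1)%N.
  rewrite (leq_trans (size_polyD _ _)) // geq_max size_bernoulli_poly /=.
  by rewrite size_polyN (leq_trans (size_polyC_leq1 _)).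
have -> : (Spoly R j).[s] = s * (drop_poly 1 (Spoly R j)).[s].
  rewrite -{1}[Spoly R j](poly_take_drop 1) hornerD hornerM hornerXn expr1.
  rewrite mulrC (_ : take_poly 1 _ = 0) ?horner0 ?add0r //.
  apply/polyP => -[|k]; rewrite coef_take_poly coef0 //=.
  by rewrite coefB coefC /= horner_coef0 subrr.
rewrite mulrA /SS; congr (_ * _).
rewrite (horner_coef_wide _ sS) mulrAC -exprSr prednK // mulr_sumr.
apply: eq_bigr => k _; have ki : (k <= i)%N by rewrite -ltnS.
have sk : s ^+ k != 0 by rewrite expf_neq0.
have -> : s ^+ i = s ^+ (i - k) * s ^+ k by rewrite -exprD subnK.
by rewrite expr_div_n [RHS]mulrCA -mulrA -mulrA; congr (_ * _);
  rewrite [s ^+ k * _]mulrCA divff // mulr1 mulrC.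
Qed.

(** Independence of the partial derivatives on D from the extension. *)

Lemma domain_closure_interior (R : realType) (D : set (plane R)) :
  compact_convex_domain D -> D `<=` closure D°.
Proof.
move=> [_ cD [p Dp]] x Dx B Bx.
have : \forall t \near (0 : R)^'+, B (x + t *: (p - x)).
  have h0 : t @[t --> (0 : R)^'+] --> (0 : R).
    by apply: cvg_at_right_filter; exact: cvg_id.
  have := cvgD (cvg_cst x) (cvgZ h0 (cvg_cst (p - x))).
  by rewrite scale0r addr0; apply.
move=> Bt.
have [t [Bty t0 t1]] : exists t : R, [/\ B (x + t *: (p - x)), 0 < t & t < 1].
  near (0 : R)^'+ => t; exists t; split.
  - by near: t.
  - by near: t; exact: nbhs_right_gt.
  - by near: t; exact: nbhs_right_lt.
exists (x + t *: (p - x)); split => //.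
have tn0 : t != 0 by rewrite gt_eqF.
rewrite /interior /=.
have cv : t^-1 *: (z - x) + x @[z --> x + t *: (p - x)] --> p.
  have cx (u : plane R) : (fun=> x) @ nbhs u --> x by exact: cvg_cst.
  have cz : t^-1 *: (z - x) @[z --> x + t *: (p - x)] -->
      t^-1 *: (x + t *: (p - x) - x).
    exact: cvgZ (cvg_cst _) (cvgB cvg_id (cx _)).
  have := cvgD cz (cx _).
  by rewrite (addrC x) addrK scalerA mulVf // scale1r subrK => h; exact: h.
have nD : nbhs (x + t *: (p - x)) [set z | D (t^-1 *: (z - x) + x)].
  exact: (cv D Dp).
apply: filterS nD => z /= Dz.
have := cD _ _ (Itv01 (ltW t0) (ltW t1)) (mem_set Dz) (mem_set Dx).
move=> /set_mem; congr (D _).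
rewrite /conv /= /unstable.onem scalerDr scalerA divff // scale1r scalerBl scale1r.
by rewrite addrACA subrK subrr addr0.
Unshelve. all: by end_near. Qed.

Lemma derivs_unique (R : realType) (m : nat) (D : set (plane R))
    (F G : plane R -> R) (s : seq 'I_2) :
  compact_convex_domain D -> Cm m F -> Cm m G -> {in D, F =1 G} ->
  (size s <= m)%N ->
  {in D, foldr (@partial R) F s =1 foldr (@partial R) G s}.
Proof.
move=> domD; elim/last_ind: s m F G => [//|s i IH] m F G CF CG FG.
rewrite size_rcons; case: m CF CG => [|m] [_ CF] [_ CG] sm; first by [].
rewrite !foldr_rcons; apply: (IH m _ _ (CF i).2 (CG i).2) => //.
move=> x /set_mem Dx; have {}CF := (CF i).2; have {}CG := (CG i).2.
have cF : continuous (partial i F) by case: (m) CF => [|k] [].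
have cG : continuous (partial i G) by case: (m) CG => [|k] [].
have cl : @closed (plane R) [set z | (partial i F \- partial i G) z = 0].
  apply: (@closed_comp _ _ (partial i F \- partial i G) [set y | y = 0]) => //.
  move=> z _; apply: (@continuousB _ _ _ (partial i F) (partial i G) z).
  - exact: cF.
  - exact: cG.
have DZ : D° `<=` [set z | (partial i F \- partial i G) z = 0].
  move=> z Dz /=; apply/eqP; rewrite subr_eq0; apply/eqP.
  by apply: near_eq_derive; apply: filterS Dz => y Dy; exact/FG/mem_set.
have := closure_subset DZ (domain_closure_interior domD Dx).
by rewrite -((closure_id _).1 cl) /= => /eqP; rewrite subr_eq0 => /eqP.
Qed.

(* Main.v *)
Require Import Defs.
From HB Require Import structures.
From mathcomp Require Import all_boot all_order all_algebra.
From mathcomp Require Import all_classical all_reals all_analysis.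
From mathcomp Require Import ring zify.
Import Order.TTheory GRing.Theory Num.Theory.
Import numFieldNormedType.Exports.
Local Open Scope classical_set_scope.
Local Open Scope ring_scope.

Set Implicit Arguments.
Unset Strict Implicit.
Unset Printing Implicit Defensive.

(** As h tends to 0, each term of the generalized Taylor polynomial tends to a
derivative of F at V1, and an identity between Bernoulli polynomials recombines
these derivatives into the Taylor polynomial.

Shrinking the triangle by the factor h multiplies a directional derivative of
order k along its sides by h^k and divides the barycentric coordinates by h. A
term of the generalized polynomial is an increment of a derivative of order
k - 1 along a vector h w, times polynomials in the barycentric coordinates of
total degree k. So the increment divided by h tends to a derivative of order k
([difference_quotient_cvg], from the mean value theorem), the remaining powers
of h turn the polynomials into their parts of degree k ([horner_scale_cvg],
[SS_shrink]), and each term has a finite limit ([edge_term_cvg],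
[face_term_cvg]).

Let U and V be the derivatives along V2 - V1 and V3 - V1, which commute by
Schwarz's theorem ([derive_comm]), and c, c' the coordinates of x - V1 in
the basis V2 - V1, V3 - V1; put s = c + c'. The limits of order k add up to
  s^k V^k / k!
  + sum over i + j = k + 1 of
      (U^j - V^j) (U - V)^(i-1) s^i S_i(c / s) s^(j-1) / (i! j!),
applied to F at V1, where i, j >= 1 and s^i S_i(c / s) stands for a form in c
and s ([homogenize]), while the Taylor term of order k is
(c U + c' V)^k / k! with c U + c' V = s V + c (U - V). Their equality is
[sum_Spoly_symbol]. It follows from the generating function
z (e^(t z) - 1) / (e^z - 1) of the S_i(t) / i!; the proof given in
[sum_Spoly_pow_diff] uses instead only the values of S_i at 0 and 1 and the
relation S_(i+1)' = (i + 1) (S_i + B_i(0)).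

To compute with products of differential operators, a homogeneous operator of
order k is encoded by a univariate polynomial, its dehomogenized symbol
([hop]); the identity is then one in {poly R}. *)

(** * Mean values, mixed derivatives and difference quotients *)

Lemma is_derive_line (R : realType) (V : normedModType R) (g : V -> R)
    (p e : V) (t : R) :
  derivable g (p + t *: e) e ->
  is_derive t 1 (fun s : R => g (p + s *: e)) ('D_e g (p + t *: e)).
Proof.
move=> dg.
have E : (fun h : R => h^-1 *: (((fun s => g (p + s *: e)) \o shift t) (h *: 1)
     - g (p + t *: e))) =
   (fun h : R => h^-1 *: ((g \o shift (p + t *: e)) (h *: e) - g (p + t *: e))).
  apply/funext => h /=; congr (_ *: (g _ - _)).
  by rewrite [h *: 1]mulr1 scalerDl addrCA.
by apply: DeriveDef; rewrite /derivable /derive E.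
Qed.

(** The mean value theorem for the restriction of g to the line through p with
direction e; the sign of t is arbitrary. *)
Lemma mean_value_along (R : realType) (V : normedModType R) (g : V -> R)
    (p e : V) (t : R) :
  (forall x, derivable g x e) ->
  exists2 s : R, `|s| <= `|t| & g (p + t *: e) - g p = t * 'D_e g (p + s *: e).
Proof.
move=> dg; pose phi (s : R) := g (p + s *: e).
pose dphi (s : R) := 'D_e g (p + s *: e).
have dphiP (s : R) : is_derive s 1 phi (dphi s) by exact/is_derive_line/dg.
have cphi (a b : R) : {within `[a, b], continuous phi}.
  apply: derivable_within_continuous => s _.
  by have := dphiP s; case.
have p0 : g p = phi 0 by rewrite /phi scale0r addr0.
have [t0|/ltW t0] := leP 0 t.
  have [s + E] := @MVT_segment _ phi dphi 0 t t0 (fun s _ => dphiP s) (cphi _ _).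
  rewrite in_itv /= => /andP[s0 st]; exists s; first by rewrite !ger0_norm.
  by rewrite p0 E subr0 mulrC.
have [s + E] := @MVT_segment _ phi dphi t 0 t0 (fun s _ => dphiP s) (cphi _ _).
rewrite in_itv /= => /andP[s0 st]; exists s.
  by rewrite !ler0_norm // lerN2.
by rewrite p0 -[LHS]opprB E sub0r mulrN opprK mulrC.
Qed.

(** Two uses of the mean value theorem, first for the increment of g in the
direction e', as a function along e, then for the derivative of g along e. *)
Lemma second_difference (R : realType) (V : normedModType R) (g : V -> R)
    (x e e' : V) (h : R) :
  (forall y, derivable g y e) -> (forall y, derivable (fun z => 'D_e g z) y e') ->
  exists st : R * R, [/\ `|st.1| <= `|h|, `|st.2| <= `|h| &
    g (x + h *: e + h *: e') - g (x + h *: e) - (g (x + h *: e') - g x)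
    = h * (h * 'D_e' (fun z => 'D_e g z) (x + st.1 *: e + st.2 *: e'))].
Proof.
move=> dg ddg; pose phi (z : V) := g (z + h *: e') - g z.
(* The difference quotients of z |-> g (z + h e') are those of g at
   a translated point. *)
have E (y : V) : (fun k : R => k^-1 *: ((g \o shift (y + h *: e')) (k *: e) -
     g (y + h *: e'))) =
   (fun k : R => k^-1 *: (((fun z => g (z + h *: e')) \o shift y) (k *: e) -
     g (y + h *: e'))).
  by apply/funext => k /=; rewrite addrA.
have d1 (y : V) : derivable (fun z => g (z + h *: e')) y e.
  by have := dg (y + h *: e'); rewrite /derivable E.
have dphi (y : V) : derivable phi y e by exact: derivableB.
have phiE (y : V) : 'D_e phi y = 'D_e g (y + h *: e') - 'D_e g y.
  by rewrite deriveB //; congr (_ - _); rewrite /derive E.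
have [s hs Es] := mean_value_along x h dphi.
have [t ht Et] := mean_value_along (x + s *: e) h ddg.
exists (s, t); split => //=; rewrite -Et -phiE -Es /phi.
by rewrite addrAC.
Qed.

Lemma cvg0_norm_le (R : realType) (s : R -> R) (c : R) :
  (forall h, `|s h| <= `|h * c|) -> s h @[h --> 0^'+] --> (0 : R).
Proof.
move=> hs; apply/norm_cvg0P.
have c0 : `|h * c| @[h --> (0:R)^'+] --> (0 : R).
  apply: cvg_at_right_filter; rewrite -[X in _ --> X](_ : `|0 * c| = 0).
    by apply: cvg_norm; apply: cvgMl; exact: cvg_id.
  by rewrite mul0r normr0.
apply: squeeze_cvgr (cvg_cst 0) c0.
by near=> h; rewrite normr_ge0 hs.
Unshelve. all: by end_near. Qed.

Lemma cvg_add_small (R : realType) (V : normedModType R) (s : R -> R) (x : V)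
    (y : R -> V) (e : V) :
  y h @[h --> 0^'+] --> x -> s h @[h --> 0^'+] --> (0 : R) ->
  y h + s h *: e @[h --> 0^'+] --> x.
Proof.
move=> yx s0; rewrite -[X in _ --> X](addr0 x) -[X in _ --> _ + X](scale0r e).
by apply: cvgD => //; apply: cvgZ => //; exact: cvg_cst.
Qed.

(** Schwarz's theorem: the second difference of g is symmetric in e and e', so
both iterated derivatives take a common value at points that tend to x. *)
Lemma derive_comm (R : realType) (V : normedModType R) (g : V -> R)
    (x e e' : V) :
  (forall y, derivable g y e) -> (forall y, derivable (fun z => 'D_e g z) y e') ->
  (forall y, derivable g y e') ->
  (forall y, derivable (fun z => 'D_e' g z) y e) ->
  {for x, continuous (fun y => 'D_e' (fun z => 'D_e g z) y)} ->
  {for x, continuous (fun y => 'D_e (fun z => 'D_e' g z) y)} ->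
  'D_e' (fun z => 'D_e g z) x = 'D_e (fun z => 'D_e' g z) x.
Proof.
move=> d1 d2 d1' d2' c12 c21.
have [st stP] := choice (fun h => second_difference x h d1 d2).
have [ts tsP] := choice (fun h => second_difference x h d1' d2').
have lim0 (s : R -> R) : (forall h, `|s h| <= `|h|) ->
    s h @[h --> 0^'+] --> (0 : R).
  by move=> hs; apply: (@cvg0_norm_le _ s 1) => h; rewrite mulr1.
have path (e1 e2 : V) (uv : R -> R * R) :
    (forall h, `|(uv h).1| <= `|h|) -> (forall h, `|(uv h).2| <= `|h|) ->
    x + (uv h).1 *: e1 + (uv h).2 *: e2 @[h --> 0^'+] --> x.
  move=> h1 h2; apply: cvg_add_small; last exact: lim0.
  by apply: cvg_add_small; [exact: cvg_cst|exact: lim0].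
have p1 : x + (st h).1 *: e + (st h).2 *: e' @[h --> 0^'+] --> x.
  by apply: path => h; case: (stP h).
have p2 : x + (ts h).1 *: e' + (ts h).2 *: e @[h --> 0^'+] --> x.
  by apply: path => h; case: (tsP h).
have l1 := cvg_comp _ _ p1 c12; have l2 := cvg_comp _ _ p2 c21.
suff l3 : 'D_e' (fun z => 'D_e g z) (x + (st h).1 *: e + (st h).2 *: e')
    @[h --> 0^'+] --> 'D_e (fun z => 'D_e' g z) x.
  exact: (cvg_unique _ l1 l3).
apply: cvg_trans l2; apply: near_eq_cvg.
near=> h; have h0 : h != 0 by rewrite gt_eqF.
have [_ _ E1] := stP h; have [_ _ E2] := tsP h.
have swap (a b c d : R) : a - b - (c - d) = a - c - (b - d) by ring.
apply: (mulfI h0); apply: (mulfI h0).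
by rewrite -[LHS]E2 -[RHS]E1 [in LHS](addrAC x) swap.
Unshelve. all: by end_near. Qed.

Lemma ddirE (R : realType) (w : plane R) (g : plane R -> R) (x : plane R) :
  ddir w g x = w 0 0 * partial 0 g x + w 0 1 * partial 1 g x.
Proof.
rewrite /ddir /dotp !big_ord_recl big_ord0 addr0 !mxE.
by rewrite (_ : lift ord0 ord0 = 1); last exact/val_inj.
Qed.

(** A function with continuous partial derivatives has one-sided directional
derivatives given by its gradient: the increment along h w is the sum of an
increment along each axis, to which the mean value theorem applies. *)
Lemma difference_quotient_cvg (R : realType) (g : plane R -> R) (V w : plane R) :
  (forall i x, derivable g x (delta_mx 0 i)) ->
  (forall i, {for V, continuous (partial i g)}) ->
  h^-1 * (g (V + h *: w) - g V) @[h --> 0^'+] --> ddir w g V.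
Proof.
move=> dg cg; pose e i : plane R := delta_mx 0 i.
pose y (h : R) := V + (h * w 0 0) *: e 0.
have /choice[s sP] : forall h, exists s : R, `|s| <= `|h * w 0 0| /\
    g (V + (h * w 0 0) *: e 0) - g V = h * w 0 0 * partial 0 g (V + s *: e 0).
  move=> h; have [s s1 s2] := mean_value_along V (h * w 0 0) (dg 0).
  by exists s.
have /choice[t tP] : forall h, exists t : R, `|t| <= `|h * w 0 1| /\
    g (y h + (h * w 0 1) *: e 1) - g (y h) =
    h * w 0 1 * partial 1 g (y h + t *: e 1).
  move=> h; have [t t1 t2] := mean_value_along (y h) (h * w 0 1) (dg 1).
  by exists t.
have cV : V @[_ --> (0 : R)^'+] --> V by exact: cvg_cst.
have p0 : V + s h *: e 0 @[h --> 0^'+] --> V.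
  apply: cvg_add_small => //; apply: (@cvg0_norm_le _ _ (w 0 0)) => h.
  exact: (sP h).1.
have p1 : y h + t h *: e 1 @[h --> 0^'+] --> V.
  apply: cvg_add_small; last first.
    by apply: (@cvg0_norm_le _ _ (w 0 1)) => h; exact: (tP h).1.
  by apply: cvg_add_small => //; apply: (@cvg0_norm_le _ _ (w 0 0)).
have l0 := cvg_comp _ _ p0 (cg 0); have l1 := cvg_comp _ _ p1 (cg 1).
have l : w 0 0 * partial 0 g (V + s h *: e 0) +
    w 0 1 * partial 1 g (y h + t h *: e 1) @[h --> 0^'+] --> ddir w g V.
  rewrite ddirE.
  exact: (cvgD (@cvgMl_tmp _ _ _ _ _ (w 0 0) _ l0)
               (@cvgMl_tmp _ _ _ _ _ (w 0 1) _ l1)).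
apply: cvg_trans l; apply: near_eq_cvg; near=> h.
have h0 : h != 0 by rewrite gt_eqF.
apply: (mulfI h0); rewrite mulVKf // mulrDr !mulrA -(sP h).2 -(tP h).2.
have -> : y h + (h * w 0 1) *: e 1 = V + h *: w.
  rewrite -addrA; congr (_ + _); apply/rowP => i; rewrite !mxE.
  by case: i => -[|[|//]] ?; rewrite /= !(mulr0, mulr1, addr0, add0r);
    congr (_ * w _ _); apply/val_inj.
by rewrite addrC addrA subrK.
Unshelve. all: by end_near. Qed.

Lemma cvg_sumr (R : realType) (T : Type) (F : set_system T) n
    (f : 'I_n -> T -> R) (a : 'I_n -> R) : Filter F ->
  (forall i, f i x @[x --> F] --> a i) ->
  \sum_(i < n) f i x @[x --> F] --> \sum_(i < n) a i.
Proof.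
move=> FF fa; apply: cvg_big => //; exact: add_continuous.
Qed.

(** * Homogeneous differential operators on C^m functions *)

Lemma Cm_continuous (R : realType) m (g : plane R -> R) : Cm m g -> continuous g.
Proof. by case: m => [|m] []. Qed.

Lemma Cm_derivable (R : realType) m (g : plane R -> R) i x :
  Cm m.+1 g -> derivable g x (delta_mx 0 i).
Proof. by move=> [_ /(_ i)[]]. Qed.

Lemma Cm_partial (R : realType) m (g : plane R -> R) i :
  Cm m.+1 g -> Cm m (partial i g).
Proof. by move=> [_ /(_ i)[]]. Qed.

Lemma Cm_leq (R : realType) n m (g : plane R -> R) :
  (n <= m)%N -> Cm m g -> Cm n g.
Proof.
elim: n m g => [|n IH] [|m] // g nm Cg; split; try exact: Cm_continuous Cg.
  by [].
move=> i; split=> [x|]; first exact: Cm_derivable Cg.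
exact: IH (Cm_partial _ Cg).
Qed.

Lemma Cm_mpartial (R : realType) n i j (g : plane R -> R) :
  Cm (i + j + n) g -> Cm n (mpartial i j g).
Proof.
have Citer k l (u : plane R -> R) o :
    Cm (k + l) u -> Cm l (iter k (partial o) u).
  by elim: k l => // k IH l; rewrite addSnnS => /IH /(Cm_partial o).
by rewrite -addnA => Cg; apply: (Citer i); apply: Citer; rewrite addnCA.
Qed.

Lemma partial_comm (R : realType) (g : plane R -> R) : Cm 2 g ->
  partial 1 (partial 0 g) = partial 0 (partial 1 g).
Proof.
move=> Cg; apply/funext => x.
have d i y : derivable g y (delta_mx 0 i) by exact: Cm_derivable Cg.
have dd i j y : derivable (partial i g) y (delta_mx 0 j).
  exact: Cm_derivable (Cm_partial i Cg).
have c i j : continuous (partial j (partial i g)).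
  exact: Cm_continuous (Cm_partial j (Cm_partial i Cg)).
by apply: derive_comm; [exact: d|exact: dd|exact: d|exact: dd|exact: c|exact: c].
Qed.

Lemma partial1_mpartial (R : realType) n i j (g : plane R -> R) :
  (i + j < n)%N -> Cm n g -> partial 1 (mpartial i j g) = mpartial i j.+1 g.
Proof.
move=> + Cg; elim: i => [//|i IH ijn].
rewrite -[mpartial i.+1 j.+1 g]/(partial 0 (mpartial i j.+1 g)).
rewrite -IH; last exact: ltnW.
apply/partial_comm/Cm_mpartial/Cm_leq/Cg; lia.
Qed.

(** The homogeneous constant-coefficient operator of order k with symbol p,
applied to g. The symbol is a binary form of degree k in the two partial
derivatives, dehomogenized by setting the second one to 1: the coefficient of
'X^i belongs to the derivative of order i in x and k - i in y. Composition of
operators becomes multiplication in {poly R}. *)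
Definition hop (R : realType) (k : nat) (p : {poly R}) (g : plane R -> R)
    (x : plane R) : R :=
  \sum_(i < k.+1) p`_i * mpartial i (k - i) g x.

(** The dehomogenized symbol of the directional derivative along w. *)
Definition symbol (R : realType) (w : plane R) : {poly R} :=
  w 0 0 *: 'X + (w 0 1)%:P.

Lemma symbolZ (R : realType) c (w : plane R) : symbol (c *: w) = c *: symbol w.
Proof.
by rewrite /symbol !mxE scalerDr scalerA -[in RHS]alg_polyC scalerA alg_polyC.
Qed.

Lemma symbolB (R : realType) (v w : plane R) :
  symbol (v - w) = symbol v - symbol w.
Proof. by rewrite /symbol !mxE scalerBl polyCB opprD addrACA. Qed.

(** A dehomogenized binary form of degree k has size at most k.+1; this is the
bound that keeps every coefficient within the range of summation of hop. *)
Lemma size_symbolXM (R : realType) b k (w : plane R) (p : {poly R}) :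
  (size p <= k.+1)%N -> (size (symbol w ^+ b * p)%R <= (b + k).+1)%N.
Proof.
have s1 : (size (symbol w) <= 2)%N.
  rewrite (leq_trans (size_polyD _ _)) // geq_max.
  rewrite (leq_trans (size_scale_leq _ _)) ?size_polyX //=.
  by rewrite (leq_trans (size_polyC_leq1 _)).
elim: b => [|b IH] sp; first by rewrite mul1r.
rewrite exprS -mulrA (leq_trans (size_polyMleq _ _)) //.
have := IH sp; lia.
Qed.

Lemma hopE (R : realType) k (p : {poly R}) (w : plane R) g x :
  (size p <= k.+1)%N ->
  hop k.+1 (p * symbol w) g x =
  \sum_(i < k.+1) p`_i * (w 0 0 * mpartial i.+1 (k - i) g x +
                          w 0 1 * mpartial i (k - i).+1 g x).
Proof.
move=> sp; rewrite /hop /symbol.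
under eq_bigr do rewrite mulrDr -scalerAr coefD coefZ coefMX coefMC mulrDl.
rewrite big_split /= big_ord_recl /= mulr0 mul0r add0r.
rewrite [X in _ + X]big_ord_recr /= [p`_k.+1]nth_default // !mul0r addr0.
rewrite -big_split /=; apply: eq_bigr => i _.
rewrite subSS subSn -1?ltnS // mulrDr !mulrA; congr (_ * _ + _ * _); exact: mulrC.
Qed.

Lemma partial_sum (R : realType) n (c : 'I_n -> R) (G : 'I_n -> plane R -> R)
    i x :
  (forall j, derivable (G j) x (delta_mx 0 i)) ->
  partial i (fun y => \sum_(j < n) c j * G j y) x =
  \sum_(j < n) c j * partial i (G j) x.
Proof.
move=> dG; rewrite /partial.
have -> : (fun y => \sum_(j < n) c j * G j y) = \sum_(j < n) (c j \*: G j).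
  by apply/funext => y; rewrite fct_sumE.
rewrite derive_sum => [|j]; last exact: derivableZ.
by apply: eq_bigr => j _; rewrite deriveZ.
Qed.

(** Commutation of the partial derivatives turns composition with a directional
derivative into multiplication of the symbol. *)
Lemma ddir_hop (R : realType) k (p : {poly R}) (w : plane R) g :
  Cm k.+1 g -> (size p <= k.+1)%N ->
  ddir w (hop k p g) = hop k.+1 (p * symbol w) g.
Proof.
move=> Cg sp; apply/funext => x.
have Cmp (i : 'I_k.+1) : Cm 1 (mpartial i (k - i) g).
  by apply: Cm_mpartial; rewrite subnKC ?addn1 // -ltnS.
rewrite ddirE !partial_sum; try by move=> j; exact: Cm_derivable (Cmp j).
rewrite hopE // !mulr_sumr -big_split /=; apply: eq_bigr => i _.
rewrite (@partial1_mpartial _ k.+1) ?subnKC // -1?ltnS //.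
by rewrite mulrDr; congr (_ + _); rewrite mulrCA.
Qed.

Lemma iter_ddir_hop (R : realType) b k (p : {poly R}) (w : plane R) g :
  Cm (b + k) g -> (size p <= k.+1)%N ->
  iter b (ddir w) (hop k p g) = hop (b + k) (symbol w ^+ b * p) g.
Proof.
elim: b => [|b IH] Cg sp; first by rewrite mul1r.
rewrite iterS IH //; last exact: Cm_leq Cg.
by rewrite ddir_hop ?size_symbolXM // mulrC mulrA -exprS.
Qed.

Lemma iter_ddir2 (R : realType) b1 b2 (v w : plane R) g :
  Cm (b1 + b2) g ->
  iter b1 (ddir v) (iter b2 (ddir w) g) =
  hop (b1 + b2) (symbol v ^+ b1 * symbol w ^+ b2) g.
Proof.
move=> Cg; have h0 : g = hop 0 1 g.
  by apply/funext => x; rewrite /hop big_ord_recl big_ord0 addr0 coef1 mul1r.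
rewrite [in LHS]h0 [iter b2 _ _]iter_ddir_hop ?size_poly1 ?addn0 //; last first.
  by apply: Cm_leq Cg; rewrite leq_addl.
rewrite iter_ddir_hop ?mulr1 //.
by have := @size_symbolXM R b2 0 w 1; rewrite mulr1 addn0 size_poly1; apply.
Qed.

Lemma hopD (R : realType) k (p q : {poly R}) g x :
  hop k (p + q) g x = hop k p g x + hop k q g x.
Proof.
by rewrite /hop -big_split; apply: eq_bigr => i _; rewrite coefD mulrDl.
Qed.

Lemma hopZ (R : realType) k c (p : {poly R}) g x :
  hop k (c *: p) g x = c * hop k p g x.
Proof.
by rewrite /hop mulr_sumr; apply: eq_bigr => i _; rewrite coefZ mulrA.
Qed.

Lemma hopB (R : realType) k (p q : {poly R}) g x :
  hop k (p - q) g x = hop k p g x - hop k q g x.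
Proof. by rewrite hopD -scaleN1r hopZ mulN1r. Qed.

Lemma hop_sum (R : realType) k n (p : 'I_n -> {poly R}) g x :
  hop k (\sum_(i < n) p i) g x = \sum_(i < n) hop k (p i) g x.
Proof.
rewrite /hop exchange_big; apply: eq_bigr => i _.
by rewrite coef_sum mulr_suml.
Qed.

(** The difference quotients of a derivative of order k converge to a derivative
of order k.+1; this is where each increment in the generalized Taylor
polynomial gains one order of differentiation. *)
Lemma hop_quotient_cvg (R : realType) k (p : {poly R}) (v w : plane R) g :
  Cm k.+1 g -> (size p <= k.+1)%N ->
  h^-1 * (hop k p g (v + h *: w) - hop k p g v) @[h --> 0^'+]
    --> hop k.+1 (p * symbol w) g v.
Proof.
move=> Cg sp.
have Cmp (i : 'I_k.+1) : Cm 1 (mpartial i (k - i) g).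
  by apply: Cm_mpartial; rewrite subnKC ?addn1 // -ltnS.
have -> : hop k.+1 (p * symbol w) g v =
    \sum_(i < k.+1) p`_i * ddir w (mpartial i (k - i) g) v.
  rewrite -ddir_hop // ddirE !partial_sum;
    try by move=> j; exact: Cm_derivable (Cmp j).
  rewrite !mulr_sumr -big_split /=; apply: eq_bigr => i _.
  by rewrite ddirE mulrDr; congr (_ + _); rewrite mulrCA.
have -> : (fun h => h^-1 * (hop k p g (v + h *: w) - hop k p g v)) =
    (fun h => \sum_(i < k.+1) p`_i * (h^-1 *
      (mpartial i (k - i) g (v + h *: w) - mpartial i (k - i) g v))).
  apply/funext => h; rewrite /hop -sumrB mulr_sumr; apply: eq_bigr => i _.
  by rewrite -mulrBr mulrCA.
apply: cvg_sumr => i.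
have l : h^-1 * (mpartial i (k - i) g (v + h *: w) - mpartial i (k - i) g v)
    @[h --> 0^'+] --> ddir w (mpartial i (k - i) g) v.
  apply: difference_quotient_cvg => [j x|j]; first exact: Cm_derivable (Cmp i).
  exact: (Cm_continuous (Cm_partial j (Cmp i))).
exact: (@cvgMl_tmp _ _ _ _ _ (p`_i) _ l).
Qed.

(** * An identity for Bernoulli polynomials *)

Lemma coef_bernoulli_poly_lead (R : realType) n : (bernoulli_poly R n)`_n = 1.
Proof.
elim: n => [|n IH]; first by rewrite coef1.
have := congr1 (fun p : {poly R} => p`_n) (deriv_bernoulli_poly R n).
rewrite coef_deriv coefZ IH mulr1 -[LHS]mulr_natl.
move/eqP; rewrite -subr_eq0 -[X in _ - X]mulr1 -mulrBr mulf_eq0 pnatr_eq0 /=.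
by rewrite subr_eq0 => /eqP.
Qed.

Lemma coef_Spoly_lead (R : realType) n : (0 < n)%N -> (Spoly R n)`_n = 1.
Proof.
by move=> n0; rewrite coefB coefC gtn_eqF // subr0 coef_bernoulli_poly_lead.
Qed.

Lemma size_Spoly (R : realType) n : (size (Spoly R n) <= n.+1)%N.
Proof.
rewrite (leq_trans (size_polyD _ _)) // geq_max size_bernoulli_poly /=.
by rewrite size_polyN (leq_trans (size_polyC_leq1 _)).
Qed.

Lemma Spoly_at0 (R : realType) n : (Spoly R n).[0] = 0.
Proof. by rewrite /Spoly !hornerE subrr. Qed.

(** The relation between B_(n+1)' and B_n, in terms of the S_n up to a constant:
the form in which the induction on k in the next identity uses it. *)
Lemma deriv_Spoly (R : realType) n :
  (Spoly R n.+1)^`() = n.+1%:R *: (Spoly R n + (bernoulli_poly R n).[0]%:P).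
Proof. by rewrite /Spoly derivB derivC subr0 deriv_bernoulli_poly subrK. Qed.

Lemma deriv_eq0_polyC (R : realType) (p : {poly R}) : p^`() = 0 -> p = p.[0]%:P.
Proof.
move=> dp; apply/polyP => -[|i]; rewrite coefC /= ?horner_coef0 //.
have := congr1 (fun p : {poly R} => p`_i) dp.
by rewrite coef_deriv coef0 => /eqP; rewrite mulrn_eq0 /= => /eqP.
Qed.

Lemma antiderivE (R : realType) (p q : {poly R}) :
  q.[0] = 0 -> q^`() = p -> antideriv p = q.
Proof.
move=> q0 dq; apply/eqP; rewrite -subr_eq0; apply/eqP.
rewrite [LHS]deriv_eq0_polyC; last by rewrite derivB deriv_antideriv dq subrr.
by rewrite hornerD hornerN q0 /antideriv hornerM hornerX mul0r subr0.
Qed.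

Lemma poly_eq0_deriv_const (R : realType) (p : {poly R}) (c : R) :
  p^`() = c%:P -> p.[0] = 0 -> p.[1] = 0 -> p = 0.
Proof.
move=> dp p0 p1; have E : c *: 'X = p.
  rewrite -[RHS](@antiderivE _ c%:P) //.
  apply/esym/antiderivE; rewrite ?hornerE ?mulr0 //.
  by rewrite derivZ derivX alg_polyC.
by move: p1; rewrite -E hornerZ hornerX mulr1 => ->; rewrite scale0r.
Qed.

(** B_(n+1)(1) - B_(n+1)(0) is n + 1 times the mean of B_n, which vanishes
unless n = 0. *)
Lemma Spoly_at1 (R : realType) n : (Spoly R n.+1).[1] = (n == 0)%N%:R.
Proof.
have n1 : n.+1%:R != 0 :> R by rewrite pnatr_eq0.
have S1 : (Spoly R n.+1).[1] =
    n.+1%:R * \int[lebesgue_measure]_(x in `[0%R, 1%R]) (bernoulli_poly R n).[x].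
  rewrite int_horner (@antiderivE _ _ (n.+1%:R^-1 *: Spoly R n.+1)).
  - by rewrite !hornerZ Spoly_at0 mulr0 subr0 mulrA divff // mul1r.
  - by rewrite hornerZ Spoly_at0 mulr0.
  - by rewrite derivZ deriv_Spoly scalerA mulVf // scale1r /Spoly subrK.
rewrite S1; case: n {S1 n1} => [|n]; last by rewrite int_bernoulli_poly mulr0.
rewrite int_horner (@antiderivE _ _ 'X) ?hornerX ?derivX //.
by rewrite subr0 mulr1.
Qed.

(** With d = U - V, this is the coefficient of z^k in
(e^(U z) - e^(V z)) (e^(t d z) - 1) / (e^(d z) - 1) = e^(V z) (e^(t d z) - 1),
where the generating function of the S_i(t) / i! is z (e^(t z) - 1) / (e^z - 1).
The proof is by induction on k. Up to a constant polynomial, the derivative in t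
of each side is U - V times the same side for k - 1, so the two sides differ by
a polynomial of degree at most 1; they agree at t = 0, where all S_i vanish, and
at t = 1, where all S_i but S_1 vanish. *)
Lemma sum_Spoly_pow_diff (R : realType) (U V : R) (k : nat) :
  \sum_(i < k) (((U ^+ (k - i) - V ^+ (k - i)) * (U - V) ^+ i) /
     (i.+1`!%:R * (k - i)`!%:R)) *: Spoly R i.+1
  = k`!%:R^-1 *: ((V%:P + (U - V) *: 'X) ^+ k - (V ^+ k)%:P).
Proof.
elim: k => [|k IH]; first by rewrite big_ord0 !expr0 subrr scaler0.
have fn0 n : n`!%:R != 0 :> R by rewrite pnatr_eq0 -lt0n fact_gt0.
have nn0 n : n.+1%:R != 0 :> R by rewrite pnatr_eq0.
pose b (i : nat) : R := (bernoulli_poly R i).[0].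
pose a (i : nat) : R := (U ^+ (k.+1 - i) - V ^+ (k.+1 - i)) * (U - V) ^+ i /
     (i`!%:R * (k.+1 - i)`!%:R).
set W : {poly R} := V%:P + (U - V) *: 'X in IH *.
set L := LHS; set T := RHS.
have dL : L^`() = \sum_(i < k.+1) a i *: Spoly R i
    + (\sum_(i < k.+1) a i * b i)%:P.
  rewrite rmorph_sum -big_split /= [LHS]raddf_sum; apply: eq_bigr => i _ /=.
  rewrite derivZ deriv_Spoly scalerA.
  rewrite [(a i * _)%:P]polyCM [(a i)%:P * _]mul_polyC -scalerDr; congr (_ *: _).
  by rewrite /a factS natrM; field; rewrite !fn0 nat1r nn0.
have dT : T^`() = ((U - V) / k`!%:R) *: W ^+ k.
  have dW : W^`() = (U - V)%:P.
    by rewrite derivD derivC add0r derivZ derivX alg_polyC.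
  rewrite derivZ derivB derivC subr0 deriv_exp dW /= mul_polyC.
  rewrite -[X in _ *: X]scaler_nat.
  rewrite scalerA [LHS]scalerA.
  by congr (_ *: _); rewrite factS natrM; field; rewrite !fn0 nat1r nn0.
apply/eqP; rewrite -subr_eq0; apply/eqP.
(* The constant by which the derivatives of the two sides differ: the values
   B_i(0) on the left, and the term V^k of the induction hypothesis. *)
pose c := \sum_(i < k.+1) a i * b i - (U - V) / k`!%:R * V ^+ k.
apply: (@poly_eq0_deriv_const _ _ c).
- rewrite derivB dL dT.
  rewrite big_ord_recl.
  have -> : Spoly R ord0 = 0 by rewrite /Spoly /= -(polyC1 R) hornerC subrr.
  have -> : \sum_(i < k) a (lift ord0 i) *: Spoly R (lift ord0 i) =
      (U - V) *: (k`!%:R^-1 *: (W ^+ k - (V ^+ k)%:P)).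
    rewrite -IH scaler_sumr; apply: eq_bigr => i _.
    rewrite scalerA /a lift0 subSS exprS; congr (_ *: _).
    by rewrite !mulrA; congr (_ / _); rewrite -!mulrA mulrCA.
  rewrite scaler0 add0r scalerA scalerBr /c rmorphB /= addrAC.
  rewrite (addrAC (_ *: _)) subrr add0r.
  by rewrite -[X in - X + _]mul_polyC -polyCM addrC.
- rewrite hornerD hornerN horner_sum big1 => [|i _].
    rewrite hornerZ hornerD hornerN horner_exp hornerD hornerC hornerZ hornerX.
    by rewrite hornerC mulr0 addr0 subrr mulr0 subrr.
  by rewrite hornerZ Spoly_at0 mulr0.
rewrite hornerD hornerN horner_sum big_ord_recl big1 => [|i _].
  rewrite hornerZ Spoly_at1 mulr1 addr0 subn0 expr0 mulr1 (_ : 1`! = 1%N) // mul1r.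
  rewrite hornerZ hornerD hornerN horner_exp hornerD !hornerC hornerZ hornerX mulr1.
  by rewrite (addrC V) subrK [X in X - _]mulrC subrr.
by rewrite hornerZ Spoly_at1 mulr0.
Qed.

(** * Homogenization and the identity for symbols *)

(** The form s^n p(a / s), which is also defined at s = 0. *)
Definition homogenize (R : realType) (n : nat) (p : {poly R}) (a s : R) : R :=
  \sum_(l < n.+1) p`_l * a ^+ l * s ^+ (n - l).

Lemma homogenizeE (R : realType) n (p : {poly R}) (a s : R) :
  (size p <= n.+1)%N -> s != 0 -> homogenize n p a s = s ^+ n * p.[a / s].
Proof.
move=> sp s0; rewrite (horner_coef_wide _ sp) mulr_sumr; apply: eq_bigr => l _.
have ln : (l <= n)%N by rewrite -ltnS.
rewrite -[in s ^+ n](subnK ln) exprD expr_div_n; field.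
by rewrite expf_neq0.
Qed.

Lemma homogenize0 (R : realType) n (p : {poly R}) (a : R) :
  homogenize n p a 0 = p`_n * a ^+ n.
Proof.
rewrite /homogenize big_ord_recr /= subnn expr0 mulr1 big1 ?add0r // => l _.
by rewrite expr0n subn_eq0 leqNgt ltn_ord mulr0.
Qed.

(** [sum_Spoly_pow_diff] at t = a / s, multiplied by s^k. For s = 0 only the
term of index i = k - 1 survives, and the leading coefficient 1 of S_k gives
the result. *)
Lemma sum_Spoly_homogeneous (R : realType) (U V a s : R) (k : nat) : (0 < k)%N ->
  \sum_(i < k) (U ^+ (k - i) - V ^+ (k - i)) * (U - V) ^+ i *
     (homogenize i.+1 (Spoly R i.+1) a s * s ^+ (k - i.+1)
      / (i.+1`!%:R * (k - i)`!%:R))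
  = ((s * V + a * (U - V)) ^+ k - (s * V) ^+ k) / k`!%:R.
Proof.
move=> k0; have [->|s0] := eqVneq s 0.
  case: k k0 => // k _; rewrite big_ord_recr /= big1 => [|i _].
    rewrite homogenize0 coef_Spoly_lead // subnn expr0 subSn // subnn !expr1.
    rewrite !mul0r !add0r expr0n subr0 exprMn [(U - V) ^+ k.+1]exprS.
    by rewrite (_ : 1`! = 1%N) // -natrM muln1 mul1r mulr1 -exprS mulrCA mulrA.
  by rewrite subSS expr0n subn_eq0 leqNgt ltn_ord !(mulr0, mul0r).
have := congr1 (fun p => s ^+ k * p.[a / s]) (@sum_Spoly_pow_diff R U V k).
rewrite horner_sum mulr_sumr hornerZ hornerD hornerN !horner_exp.
rewrite hornerD !hornerC hornerZ hornerX => E.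
transitivity (s ^+ k * (k`!%:R^-1 * ((V + (U - V) * (a / s)) ^+ k - V ^+ k))).
  rewrite -E; apply: eq_bigr => i _.
  rewrite homogenizeE ?size_Spoly // hornerZ.
  have -> : s ^+ k = s ^+ i.+1 * s ^+ (k - i.+1) by rewrite -exprD subnKC.
  have aux (c A S B D : R) : c * (A * S * B * D) = A * B * (c * D * S) by ring.
  exact: aux.
rewrite mulrCA mulrC mulrBr -!exprMn; congr ((_ ^+ _ - _) / _).
by field.
Qed.

Lemma poly_horner_inj (R : realType) (p q : {poly R}) :
  (forall x, p.[x] = q.[x]) -> p = q.
Proof.
move=> pq; apply/eqP; rewrite -subr_eq0; apply/negP => /negP d0.
(* The integers 0, 1, ... would be more roots of p - q than its degree. *)
pose r := [seq i%:R : R | i <- iota 0 (size (p - q))].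
have := @max_poly_roots _ _ r d0.
rewrite size_map size_iota ltnn => H; suff : false by [].
apply: H; last first.
  by rewrite map_inj_uniq ?iota_uniq // => i j /eqP; rewrite eqr_nat => /eqP.
by apply/allP => x _; rewrite /root hornerD hornerN pq subrr.
Qed.

(** The same identity for U and V in {poly R}: it holds at every value of the
variable, and a real polynomial is determined by its values. It applies to the
symbols of directional derivatives. *)
Lemma sum_Spoly_symbol (R : realType) (U V : {poly R}) (a s : R) (k : nat) :
  (0 < k)%N ->
  \sum_(i < k) (homogenize i.+1 (Spoly R i.+1) a s * s ^+ (k - i.+1)
      / (i.+1`!%:R * (k - i)`!%:R))
     *: ((U ^+ (k - i) - V ^+ (k - i)) * (U - V) ^+ i)
  = k`!%:R^-1 *: ((s *: V + a *: (U - V)) ^+ k - s ^+ k *: V ^+ k).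
Proof.
move=> k0; apply: poly_horner_inj => x.
rewrite hornerZ !(hornerD, hornerN, hornerZ, horner_exp) -exprMn mulrC.
rewrite -sum_Spoly_homogeneous // horner_sum; apply: eq_bigr => i _.
by rewrite hornerZ hornerM !(hornerD, hornerN, horner_exp) mulrC.
Qed.

(** Only the leading term survives: h^n p(c / h) is the homogenization of p at
(c, h), which is continuous in h. *)
Lemma horner_scale_cvg (R : realType) n (p : {poly R}) (c : R) :
  (size p <= n.+1)%N ->
  h ^+ n * p.[c / h] @[h --> 0^'+] --> p`_n * c ^+ n.
Proof.
move=> sp; rewrite -homogenize0.
have l : homogenize n p c h @[h --> 0^'+] --> homogenize n p c 0.
  apply: cvg_sumr => i.
  have lx : h ^+ (n - i) @[h --> 0^'+] --> (0 : R) ^+ (n - i).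
    exact/cvg_at_right_filter/exprn_continuous.
  exact: (@cvgMl_tmp _ _ _ _ _ (p`_i * c ^+ i) _ lx).
apply: cvg_trans l; apply: near_eq_cvg; near=> h.
by rewrite homogenizeE // gt_eqF.
Unshelve. all: by end_near. Qed.

(** * The Taylor polynomial by orders of differentiation *)

Lemma sum_antidiagonals (R : realType) n (G : nat -> nat -> R) :
  \sum_(a < n) \sum_(b < n - a) G a b =
  \sum_(k < n) \sum_(a < k.+1) G a (k - a)%N.
Proof.
elim: n => [|n IH]; first by rewrite !big_ord0.
rewrite [RHS]big_ord_recr -IH /=.
have -> : \sum_(a < n.+1) \sum_(b < n.+1 - a) G a b =
    \sum_(a < n.+1) (\sum_(b < n - a) G a b + G a (n - a)%N).
  apply: eq_bigr => a _; rewrite subSn -1?ltnS //; exact: big_ord_recr.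
rewrite big_split /=; congr (_ + _).
by rewrite big_ord_recr /= subnn big_ord0 addr0.
Qed.

(** The binomial theorem groups the terms of order k of the Taylor polynomial
into the k-th power of the derivative along x - v, divided by k!. *)
Lemma taylor_hop (R : realType) m (g : plane R -> R) (v x : plane R) :
  taylor m g v x =
  \sum_(k < m.+1) k`!%:R^-1 * hop k (symbol (x - v) ^+ k) g v.
Proof.
pose G a b := mpartial a b g v / (a`!%:R * b`!%:R)
    * (x 0 0 - v 0 0) ^+ a * (x 0 1 - v 0 1) ^+ b.
have -> : taylor m g v x = \sum_(a < m.+1) \sum_(b < m.+1 - a) G a b.
  apply: eq_bigr => a _; rewrite (big_ord_widen_cond m.+1 xpredT) ?leq_subr //.
  by apply: eq_bigl => b; rewrite andTb; have := ltn_ord a; lia.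
rewrite sum_antidiagonals; apply: eq_bigr => k _.
rewrite /hop mulr_sumr; apply: eq_bigr => i _.
have ik : (i <= k)%N by rewrite -ltnS.
have -> : (symbol (x - v) ^+ k)`_i =
    (x 0 0 - v 0 0) ^+ i * (x 0 1 - v 0 1) ^+ (k - i) *+ 'C(k, i).
  rewrite /symbol !mxE [_ *: _ + _]addrC exprDn coef_sum.
  rewrite (bigD1 i) //= big1 => [|j ji].
    rewrite addr0 coefMn exprZn -polyC_exp mul_polyC !coefZ coefXn eqxx mulr1.
    by rewrite mulrC.
  rewrite coefMn exprZn -polyC_exp mul_polyC !coefZ coefXn.
  by rewrite eq_sym (negbTE (_ : (j : nat) != i)) // ?mulr0 ?mul0rn.
have fn0 n : n`!%:R != 0 :> R by rewrite pnatr_eq0 -lt0n fact_gt0.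
rewrite /G -(bin_fact ik) !natrM -[_ *+ 'C(k, i)]mulr_natr.
have : 'C(k, i)%:R != 0 :> R by rewrite pnatr_eq0 -lt0n bin_gt0.
move: (fn0 i) (fn0 (k - i)%N) => i0 ki0 C0.
field; rewrite ?i0 ?ki0 ?C0 //.
Qed.

(** * Shrinking the triangle *)

Lemma area_detE (R : realType) (p q r : plane R) :
  area_det p q r = (q 0 0 - p 0 0) * (r 0 1 - p 0 1)
                   - (q 0 1 - p 0 1) * (r 0 0 - p 0 0).
Proof.
(* The matrix by rows, with entries that reduce at each numeral index. *)
pose e : seq (seq R) := [:: [:: 1; 1; 1]; [:: p 0 0; q 0 0; r 0 0];
  [:: p 0 1; q 0 1; r 0 1]].
have -> : area_det p q r = \det (\matrix_(i < 3, j < 3) (nth [::] e i)`_j).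
  congr (\det _); apply/matrixP => -[i hi] [j hj]; rewrite !mxE.
  case: fintype.splitP => [[[|//] h1] /= ->|[k hk] /= Ek].
    by rewrite mxE /=; case: j hj => [|[|[|]]].
  case: i hi Ek => [//|i] hi [Ek]; subst i.
  case: k hk {hi} => [|[|//]] hk; case: j hj => [|[|[|//]]] hj /=;
    rewrite (tnth_nth p) /=; congr (_ _ _); exact: val_inj.
rewrite (expand_det_row _ 0) !big_ord_recl big_ord0 addr0.
rewrite /cofactor.
do ?rewrite (expand_det_row _ 0) !big_ord_recl !big_ord0 /cofactor.
by rewrite !det_mx00 !mxE /=; ring.
Qed.

Lemma area_det_shrink2 (R : realType) (p q r : plane R) (h : R) :
  area_det p (p + h *: (q - p)) r = h * area_det p q r.
Proof. by rewrite !area_detE !mxE; ring. Qed.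

Lemma area_det_shrink3 (R : realType) (p q r : plane R) (h : R) :
  area_det p q (p + h *: (r - p)) = h * area_det p q r.
Proof. by rewrite !area_detE !mxE; ring. Qed.

Lemma bary2_shrink (R : realType) (v v2 v3 x : plane R) (h : R) : h != 0 ->
  bary2 v (v + h *: (v2 - v)) (v + h *: (v3 - v)) x = bary2 v v2 v3 x / h.
Proof.
move=> h0; rewrite /bary2 area_det_shrink2 !area_det_shrink3.
by rewrite -mulf_div divff // mul1r invfM mulrCA mulrC.
Qed.

Lemma bary3_shrink (R : realType) (v v2 v3 x : plane R) (h : R) : h != 0 ->
  bary3 v (v + h *: (v2 - v)) (v + h *: (v3 - v)) x = bary3 v v2 v3 x / h.
Proof.
move=> h0; rewrite /bary3 area_det_shrink2 area_det_shrink3 area_det_shrink2.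
by rewrite -mulf_div divff // mul1r invfM mulrCA mulrC.
Qed.

(** Cramer's rule for x - v in the basis formed by the two sides at v. *)
Lemma symbol_barycentric (R : realType) (v v2 v3 x : plane R) :
  area_det v v2 v3 != 0 ->
  symbol (x - v) = bary2 v v2 v3 x *: symbol (v2 - v)
                   + bary3 v v2 v3 x *: symbol (v3 - v).
Proof.
rewrite /bary2 /bary3 !area_detE => d0.
rewrite -!symbolZ /symbol -[RHS]addrACA -scalerDl -polyCD !mxE.
by congr (_ *: _ + _%:P); field.
Qed.

(** The operators attached to the shrunk triangle are multiples by powers of h
of operators attached to the original one, with signs that come from the
directions that point towards v. *)
Lemma Dop1_shrink (R : realType) n (v u w y : plane R) (h : R)
    (g : plane R -> R) :
  Cm n g ->
  Dop1 v u (v + h *: w) 0 n g y = h ^+ n * hop n (symbol w ^+ n) g y.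
Proof.
move=> Cg; rewrite /Dop1 iter_ddir2 // mul1r addrAC subrr add0r symbolZ exprZn.
exact: hopZ.
Qed.

Lemma Dop2_shrink (R : realType) a b (v w2 w3 y : plane R) (h : R)
    (g : plane R -> R) :
  Cm (b + a) g ->
  Dop2 v (v + h *: w2) (v + h *: w3) b a g y =
  (-1) ^+ (a + b) * (h ^+ (a + b)
    * hop (b + a) (symbol w2 ^+ b * symbol (w2 - w3) ^+ a) g y).
Proof.
move=> Cg; rewrite /Dop2 iter_ddir2 //.
have -> : v - (v + h *: w2) = (- h) *: w2 by rewrite opprD addNKr scaleNr.
have -> : v + h *: w3 - (v + h *: w2) = (- h) *: (w2 - w3).
  by rewrite opprD addrACA subrr add0r -scalerBr scaleNr -scalerN opprB.
rewrite !symbolZ !exprZn -scalerAl -scalerAr scalerA hopZ mulrA -exprMn mulN1r.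
by rewrite -exprD addnC.
Qed.

Lemma Dop3_shrink (R : realType) a b (v w2 w3 y : plane R) (h : R)
    (g : plane R -> R) :
  Cm (b + a) g ->
  Dop3 v (v + h *: w2) (v + h *: w3) b a g y =
  (-1) ^+ b * (h ^+ (a + b)
    * hop (b + a) (symbol w3 ^+ b * symbol (w2 - w3) ^+ a) g y).
Proof.
move=> Cg; rewrite /Dop3 iter_ddir2 //.
have -> : v - (v + h *: w3) = (- h) *: w3 by rewrite opprD addNKr scaleNr.
have -> : v + h *: w2 - (v + h *: w3) = h *: (w2 - w3).
  by rewrite opprD addrACA subrr add0r -scalerBr.
rewrite !symbolZ !exprZn -scalerAl -scalerAr scalerA hopZ mulrA.
by rewrite [(- h) ^+ b]exprNn exprD -!mulrA; congr (_ * _); rewrite mulrCA.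
Qed.

(** The first factor of SS is a form of degree a.+1, so it scales exactly; only
the second factor requires a limit. *)
Lemma SS_shrink (R : realType) a b (c s h : R) : h != 0 ->
  h ^+ (a + b).+1 * SS a.+1 b.+1 (c / h) (s / h) =
  homogenize a.+1 (Spoly R a.+1) c s
    * (h ^+ b * (drop_poly 1 (Spoly R b.+1)).[s / h]).
Proof.
move=> h0; rewrite /SS -/(homogenize a.+1 (Spoly R a.+1) (c / h) (s / h)).
have -> : homogenize a.+1 (Spoly R a.+1) c s =
    h ^+ a.+1 * homogenize a.+1 (Spoly R a.+1) (c / h) (s / h).
  rewrite /homogenize mulr_sumr; apply: eq_bigr => k _.
  have -> : h ^+ a.+1 = h ^+ k * h ^+ (a.+1 - k).
    by rewrite -exprD subnKC // -ltnS.
  rewrite !expr_div_n; field; by rewrite !expf_neq0.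
by rewrite -addSn exprD mulrACA.
Qed.

(** * Limits of the terms *)

(** Of the factor h^(n+1) that turns S_(n+1)(s / h) into s^(n+1) in the limit, n
powers come from the operator of order n, and the last one is compensated by
dividing the increment of the derivative by h. *)
Lemma edge_term_cvg (R : realType) n (v : plane R) (u : R -> plane R)
    (w : plane R) (s : R) (g : plane R -> R) :
  Cm n.+1 g ->
  (Dop1 v (u h) (v + h *: w) 0 n g (v + h *: w)
   - Dop1 v (u h) (v + h *: w) 0 n g v)
    * ((Spoly R n.+1).[s / h] / n.+1`!%:R) @[h --> 0^'+] -->
  s ^+ n.+1 / n.+1`!%:R * hop n.+1 (symbol w ^+ n.+1) g v.
Proof.
move=> Cg; have szw : (size (symbol w ^+ n)%R <= n.+1)%N.
  by have := @size_symbolXM R n 0 w 1; rewrite mulr1 addn0 size_poly1; apply.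
have l1 : h^-1 * (hop n (symbol w ^+ n) g (v + h *: w) - hop n (symbol w ^+ n) g v)
    @[h --> 0^'+] --> hop n.+1 (symbol w ^+ n.+1) g v.
  by rewrite exprSr; exact: hop_quotient_cvg.
have l2 : h ^+ n.+1 * (Spoly R n.+1).[s / h] / n.+1`!%:R @[h --> 0^'+]
    --> s ^+ n.+1 / n.+1`!%:R.
  have := @horner_scale_cvg _ _ _ s (size_Spoly R n.+1).
  by rewrite coef_Spoly_lead // mul1r => l; exact: (@cvgMr_tmp _ _ _ _ _ _ _ l).
have l : h ^+ n.+1 * (Spoly R n.+1).[s / h] / n.+1`!%:R
    * (h^-1 * (hop n (symbol w ^+ n) g (v + h *: w) - hop n (symbol w ^+ n) g v))
    @[h --> 0^'+] --> s ^+ n.+1 / n.+1`!%:R * hop n.+1 (symbol w ^+ n.+1) g v.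
  exact: cvgM l2 l1.
apply: cvg_trans l; apply: near_eq_cvg; near=> h.
have h0 : h != 0 by rewrite gt_eqF.
rewrite !Dop1_shrink; try exact: Cm_leq Cg.
rewrite -mulrBr exprS; set P := _.[_]; set A := hop _ _ _ _ - _.
by rewrite -[RHS](mulfK h0); ring.
Unshelve. all: by end_near. Qed.

(** The powers of h balance as for the edge terms: the two operators of order
a + b contribute h^(a+b), and the increments along w2 and w3 one more factor
h. The signs cancel those of Dop2 and Dop3 and leave a difference. *)
Lemma face_term_cvg (R : realType) a b (v w2 w3 : plane R) (c s : R)
    (g : plane R -> R) :
  Cm (a + b).+1 g ->
  ((-1) ^+ (a.+1 + b.+1)
     * (Dop2 v (v + h *: w2) (v + h *: w3) b a g (v + h *: w2)
        - Dop2 v (v + h *: w2) (v + h *: w3) b a g v)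
   + (-1) ^+ b.+1
     * (Dop3 v (v + h *: w2) (v + h *: w3) b a g (v + h *: w3)
        - Dop3 v (v + h *: w2) (v + h *: w3) b a g v))
  * (SS a.+1 b.+1 (c / h) (s / h) / (a.+1`!%:R * b.+1`!%:R)) @[h --> 0^'+] -->
  homogenize a.+1 (Spoly R a.+1) c s * s ^+ b / (a.+1`!%:R * b.+1`!%:R)
   * hop (a + b).+1 ((symbol w2 ^+ b.+1 - symbol w3 ^+ b.+1)
                     * (symbol w2 - symbol w3) ^+ a) g v.
Proof.
move=> Cg; pose d := symbol (w2 - w3) ^+ a.
have sz w : (size (symbol w ^+ b * d)%R <= (a + b).+1)%N.
  rewrite addnC; apply: size_symbolXM.
  have := @size_symbolXM R a 0 (w2 - w3) 1.
  by rewrite mulr1 addn0 size_poly1; apply.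
have l1 w : h^-1 * (hop (a + b) (symbol w ^+ b * d) g (v + h *: w)
                    - hop (a + b) (symbol w ^+ b * d) g v)
    @[h --> 0^'+] --> hop (a + b).+1 (symbol w ^+ b.+1 * d) g v.
  by rewrite exprSr mulrAC; exact: hop_quotient_cvg.
have l2 : h ^+ b * (drop_poly 1 (Spoly R b.+1)).[s / h] @[h --> 0^'+] --> s ^+ b.
  have sd : (size (drop_poly 1 (Spoly R b.+1)) <= b.+1)%N.
    by rewrite size_drop_poly leq_subLR add1n size_Spoly.
  have := @horner_scale_cvg _ _ _ s sd.
  by rewrite coef_drop_poly addn1 coef_Spoly_lead // mul1r.
set H := homogenize a.+1 (Spoly R a.+1) c s.
have l3 : H * (h ^+ b * (drop_poly 1 (Spoly R b.+1)).[s / h])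
    / (a.+1`!%:R * b.+1`!%:R) @[h --> 0^'+]
    --> H * s ^+ b / (a.+1`!%:R * b.+1`!%:R).
  exact: (@cvgMr_tmp _ _ _ _ _ _ _ (@cvgMl_tmp _ _ _ _ _ H _ l2)).
have -> : hop (a + b).+1 ((symbol w2 ^+ b.+1 - symbol w3 ^+ b.+1)
     * (symbol w2 - symbol w3) ^+ a) g v =
   hop (a + b).+1 (symbol w2 ^+ b.+1 * d) g v
    - hop (a + b).+1 (symbol w3 ^+ b.+1 * d) g v.
  by rewrite -symbolB mulrBl hopB.
pose Q w h := h^-1 * (hop (a + b) (symbol w ^+ b * d) g (v + h *: w)
                    - hop (a + b) (symbol w ^+ b * d) g v).
have l : H * (h ^+ b * (drop_poly 1 (Spoly R b.+1)).[s / h])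
    / (a.+1`!%:R * b.+1`!%:R) * (Q w2 h - Q w3 h) @[h --> 0^'+] -->
    H * s ^+ b / (a.+1`!%:R * b.+1`!%:R) *
    (hop (a + b).+1 (symbol w2 ^+ b.+1 * d) g v
    - hop (a + b).+1 (symbol w3 ^+ b.+1 * d) g v).
  exact: cvgM l3 (cvgB (l1 w2) (l1 w3)).
apply: cvg_trans l; apply: near_eq_cvg; near=> h.
have h0 : h != 0 by rewrite gt_eqF.
have Cg' : Cm (b + a) g by rewrite addnC; exact: Cm_leq Cg.
rewrite /Q !Dop2_shrink // !Dop3_shrink // -/d [(b + a)%N]addnC.
rewrite -SS_shrink // -!mulrBr.
rewrite addSn addnS !exprS.
set P := SS _ _ _ _; set A := hop _ _ _ _ - _; set B := hop _ _ _ _ - _.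
have s1 n : (-1 : R) ^+ n * (-1) ^+ n = 1.
  by rewrite -exprMn mulrNN mulr1 expr1n.
(* The squares of the signs are 1, so that the signs of Dop2 and Dop3 cancel
   the explicit ones up to a relative factor -1. *)
have signs (e e' K F : R) : e * e = 1 -> e' * e' = 1 ->
    h * K * P * F * (h^-1 * (A - B)) =
    (-1 * (-1 * e') * (e' * (K * A)) + -1 * e * (e * (K * B))) * (P * F).
  move=> ee ee'; transitivity ((e' * e' * (K * A) - e * e * (K * B)) * (P * F)).
    by rewrite ee ee'; field.
  by ring.
exact: signs.
Unshelve. all: by end_near. Qed.

Theorem mainTheorem5 (R : realType) (m : nat) (D : set (plane R))
    (V1 V2 V3 : plane R) (f F : plane R -> R)
    (m_ge1 : (1 <= m)%N)
    (domD : compact_convex_domain D)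
    (DV1 : D V1) (DV2 : D V2) (DV3 : D V3)
    (nondegenerate : area_det V1 V2 V3 != 0)
    (f_Cm1 : Cm1_on m D f)
    (F_ext : Cm_ext m D f F) :
  forall x : plane R, D x ->
    gen_taylor m V1 (V1 + h *: (V2 - V1)) (V1 + h *: (V3 - V1)) F x
      @[h --> 0^'+] --> taylor m F V1 x.
Proof.
move=> x _; have [CF _] := F_ext.
pose w2 := V2 - V1; pose w3 := V3 - V1.
pose c := bary2 V1 V2 V3 x; pose s := c + bary3 V1 V2 V3 x.
pose edge n h : R :=
  (Dop1 V1 (V1 + h *: w2) (V1 + h *: w3) 0 n F (V1 + h *: w3)
   - Dop1 V1 (V1 + h *: w2) (V1 + h *: w3) 0 n F V1)
    * ((Spoly R n.+1).[s / h] / n.+1`!%:R).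
pose face a b h : R :=
  ((-1) ^+ (a.+1 + b.+1)
     * (Dop2 V1 (V1 + h *: w2) (V1 + h *: w3) b a F (V1 + h *: w2)
        - Dop2 V1 (V1 + h *: w2) (V1 + h *: w3) b a F V1)
   + (-1) ^+ b.+1
     * (Dop3 V1 (V1 + h *: w2) (V1 + h *: w3) b a F (V1 + h *: w3)
        - Dop3 V1 (V1 + h *: w2) (V1 + h *: w3) b a F V1))
  * (SS a.+1 b.+1 (c / h) (s / h) / (a.+1`!%:R * b.+1`!%:R)).
pose edge0 n := s ^+ n.+1 / n.+1`!%:R * hop n.+1 (symbol w3 ^+ n.+1) F V1.
pose face0 a b :=
  homogenize a.+1 (Spoly R a.+1) c s * s ^+ b / (a.+1`!%:R * b.+1`!%:R)
   * hop (a + b).+1 ((symbol w2 ^+ b.+1 - symbol w3 ^+ b.+1)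
                     * (symbol w2 - symbol w3) ^+ a) F V1.
(* The sums are indexed from 0, by n = j - 1, a = i - 1 and b = j - 1. *)
have lim_sums : F V1 + \sum_(n < m) edge n h
    + \sum_(a < m) \sum_(b < m - a) face a b h @[h --> 0^'+] -->
    F V1 + \sum_(n < m) edge0 n + \sum_(a < m) \sum_(b < m - a) face0 a b.
  apply: cvgD.
    apply: cvgD; first exact: cvg_cst.
    apply: cvg_sumr => n.
    by apply: (@edge_term_cvg _ n V1 (fun h => V1 + h *: w2)); exact: Cm_leq CF.
  apply: cvg_sumr => a; apply: cvg_sumr => b; apply: face_term_cvg.
  by apply: (@Cm_leq _ _ m) => //; have := ltn_ord b; lia.
have -> : taylor m F V1 x =
    F V1 + \sum_(n < m) edge0 n + \sum_(a < m) \sum_(b < m - a) face0 a b.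
  rewrite taylor_hop big_ord_recl sum_antidiagonals -addrA -big_split.
  congr (_ + _).
    by rewrite /hop big_ord_recl big_ord0 addr0 expr0 coef1 /= mul1r invr1 mul1r.
  apply: eq_bigr => k _; rewrite lift0 /= (symbol_barycentric x nondegenerate).
  rewrite -/c -/w2 -/w3.
  have -> : c *: symbol w2 + bary3 V1 V2 V3 x *: symbol w3 =
      s *: symbol w3 + c *: (symbol w2 - symbol w3).
    by rewrite /s scalerDl scalerBr [RHS]addrC addrA subrK.
  (* The total order is k + 1 = i + j - 1: the face terms of that order add up
     to the difference between the Taylor term and the edge term. *)
  have := @sum_Spoly_symbol _ (symbol w2) (symbol w3) c s k.+1 isT.
  rewrite [_ *: (_ ^+ _ - _)]scalerBr => /eqP; rewrite eq_sym subr_eq => /eqP E.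
  rewrite -hopZ E hopD hop_sum [LHS]addrC; congr (_ + _).
    by rewrite /edge0 scalerA hopZ [_^-1 * _]mulrC.
  apply: eq_bigr => a _; have ak : (a <= k)%N by rewrite -ltnS.
  by rewrite hopZ /face0 subnKC // subSS subSn.
apply: cvg_trans lim_sums; apply: near_eq_cvg; near=> h.
have h0 : h != 0 by rewrite gt_eqF.
rewrite /gen_taylor bary2_shrink // bary3_shrink // -mulrDl -/c -/s.
congr (_ + _ + _).
  by rewrite big_add1 big_mkord.
rewrite big_add1 big_mkord; apply: eq_bigr => a _.
rewrite big_add1 /= (_ : (m - a.+1 + 1)%N = (m - a)%N).
  by rewrite big_mkord.
by have := ltn_ord a; lia.
Unshelve. all: by end_near. Qed.
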